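(* Let $\Phi$ be a homogeneous Poisson point process on $\mathbb{R}^2$ with intensity $\lambda>0$. Let $\boldsymbol{x}_{\rm s},\boldsymbol{x}_{\rm d}\in\mathbb{R}^2$, $\boldsymbol{w}=\frac{\boldsymbol{x}_{\rm s}+\boldsymbol{x}_{\rm d}}{2}$, $d=\|\boldsymbol{x}_{\rm s}-\boldsymbol{w}\|$, and $\widehat{s}(\boldsymbol{x})=\max\{\|\boldsymbol{x}_{\rm s}-\boldsymbol{x}\|,\|\boldsymbol{x}-\boldsymbol{x}_{\rm d}\|\}$. Let $\boldsymbol{X}_{\rm mid}$ and $\boldsymbol{X}_{(2)}$ be the closest and the second closest points of $\Phi$ to $\boldsymbol{w}$, and let $\mathcal{E}_{\rm suff}$ be the event $$\mathcal{E}_{\rm suff}=\left\{\widehat{s}(\boldsymbol{X}_{\rm mid})\le\sqrt{d^2+\|\boldsymbol{X}_{(2)}-\boldsymbol{w}\|^2}\right\}.$$ Then $$\mathsf{Pr}(\mathcal{E}_{\rm suff})=e^{\lambda\pi d^2}\operatorname{erfc}\left(\sqrt{\lambda\pi}\,d\right).$$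
   Context: $\|\cdot\|$ is the Euclidean norm. $\operatorname{erfc}(x)=\frac{2}{\sqrt{\pi}}\int_x^\infty e^{-t^2}\,dt$ is the complementary error function. The points $\boldsymbol{X}_{\rm mid}$ and $\boldsymbol{X}_{(2)}$ are almost surely well defined and unique. *)

(* Defs.v *)
From HB Require Import structures.
From mathcomp Require Import all_boot all_order all_algebra.
From mathcomp Require Import all_classical all_reals all_analysis.
From mathcomp Require Import measurable_realfun.

Set Implicit Arguments.
Unset Strict Implicit.
Unset Printing Implicit Defensive.

Import Order.TTheory GRing.Theory Num.Theory.
Import numFieldNormedType.Exports.

Local Open Scope classical_set_scope.
Local Open Scope ring_scope.

(* The norm `|x| that the library puts on R * R is the max norm. *)
Definition enorm {R : realType} (x : R * R) : R :=
  Num.sqrt (x.1 ^+ 2 + x.2 ^+ 2).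

Definition area {R : realType} (A : set (R * R)) : \bar R :=
  (@lebesgue_measure R \x @lebesgue_measure R)%E A.

Definition erfc {R : realType} (x : R) : R :=
  2 / Num.sqrt pi *
  \int[@lebesgue_measure R]_(t in `[x, +oo[) expR (- t ^+ 2).

Section point_processes.
Context {d : measure_display} {T : measurableType d} {R : realType}.
Implicit Types (Phi : T -> set (R * R)) (A B : set (R * R)).

(* Cardinality of the part of the configuration lying in A, possibly +oo. *)
Definition count_in Phi A (omega : T) : \bar R :=
  counting (Phi omega `&` A).

(* A simple point process, as a random locally finite set of points. Bounded
   sets for the max norm and for the Euclidean norm coincide. *)
Definition point_process Phi : Prop :=
  (forall omega B, bounded_set B -> finite_set (Phi omega `&` B)) /\
  (forall A, measurable A -> measurable_fun [set: T] (count_in Phi A)).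

Definition count_event Phi A (k : nat) : set T :=
  [set omega | count_in Phi A omega = k%:R%:E].

(* [poisson_prob r] is the Dirac measure at 0 for r = 0, as needed for null
   sets A ([poisson_pmf] is junk there); its second argument is unused. *)
Definition homogeneous_poisson (P : probability T R) (lam : R) Phi : Prop :=
  [/\ point_process Phi,
      forall A (k : nat), measurable A -> bounded_set A ->
        P (count_event Phi A k) =
        poisson_prob (lam * fine (area A)) 0 [set k]
    & forall (n : nat) (A : 'I_n -> set (R * R)) (k : 'I_n -> nat),
        (forall i, measurable (A i)) -> (forall i, bounded_set (A i)) ->
        trivIset [set: 'I_n] A ->
        P (\bigcap_(i in [set: 'I_n]) count_event Phi (A i) (k i)) =
        (\prod_(i < n) P (count_event Phi (A i) (k i)))%E].

End point_processes.

Section nearest_points.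
Context {R : realType}.
Implicit Types (S : set (R * R)) (c xs xd x : R * R).

(* The unique point of S closest to c, and c itself if S has no unique closest
   point. For the homogeneous Poisson process the latter case, here and in
   [second_nearest], has probability 0. *)
Definition nearest S c : R * R :=
  xget c [set x | S x /\
    forall y, S y -> y <> x -> enorm (x - c) < enorm (y - c)].

Definition second_nearest S c : R * R :=
  nearest (S `\ nearest S c) c.

Definition midpoint xs xd : R * R := 2^-1 *: (xs + xd).

Definition shat xs xd x : R :=
  Num.max (enorm (xs - x)) (enorm (x - xd)).

End nearest_points.

Definition E_suff {d : measure_display} {T : measurableType d} {R : realType}
    (Phi : T -> set (R * R)) (xs xd : R * R) : set T :=
  let w := midpoint xs xd in
  let dist := enorm (xs - w) in
  [set omega |
    let X_mid := nearest (Phi omega) w in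
    let X_2 := second_nearest (Phi omega) w in
    shat xs xd X_mid <= Num.sqrt (dist ^+ 2 + enorm (X_2 - w) ^+ 2)].

(* Main.v *)
(* Translating by w and writing u = xs - w, the inequality defining the event is
   g(X_mid) <= |X_2 - w|^2 with g(x) = |x - w|^2 + 2 |u . (x - w)|. Almost surely
   the points have distinct distances to w, and then it says that some point x of
   Phi has no other point of Phi in the disc of squared radius g(x) around w.
   Cutting the plane along the level sets {k h <= g < (k + 1) h} and replacing
   g(x) by (k + 1) h or k h squeezes this probability, for every h > 0, between
   exp(-lam pi h) I and exp(lam pi h) I, where I is the integral over the plane
   of lam exp(-lam pi g). A rotation taking u to a coordinate axis splits I into
   two Gaussian integrals, one of which gives erfc after completing the square. *)
Require Import Defs.
From HB Require Import structures.
From mathcomp Require Import all_boot all_order all_algebra.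
From mathcomp Require Import all_classical all_reals all_analysis.
From mathcomp Require Import measurable_realfun ring lra.

Set Implicit Arguments.
Unset Strict Implicit.
Unset Printing Implicit Defensive.

Import Order.TTheory GRing.Theory Num.Theory.
Import numFieldNormedType.Exports.

Local Open Scope classical_set_scope.
Local Open Scope ring_scope.

(** * Affine and rigid changes of variables *)

(** The hypothesis on [Phi] speaks only of numbers of points in bounded measurable sets, so every
    probability is reduced to counts in such sets. Write L for the level set of index k. A single
    point in the disc of squared radius (k + 1) h, lying in L, has probability lam |L| exp(-lam pi
    (k + 1) h), and these events are disjoint for different k. Conversely, a witness in L leaves the
    disc of squared radius k h free of other points, an event of probability at most lam |L|
    exp(-lam pi k h). Since the area of a disc is linear in its squared radius, the two exponents
    differ by exactly lam pi h for every k, and this uniform factor survives the summation over k. A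
    separate obstacle is measurability: [P] need not be complete and [E_suff] is built from points
    selected with a default value, so the event must be described on every configuration, including
    those of probability 0, by countably many counts. *)

Lemma lebesgue_integral_affine_gt0 (R : realType) (a b : R) (f : R -> \bar R) :
  0 < a -> measurable_fun [set: R] f -> (forall x, (0 <= f x)%E) ->
  (\int[@lebesgue_measure R]_x f (a * x + b)%R =
   (a^-1)%:E * \int[@lebesgue_measure R]_x f x)%E.
Proof.
move=> a0 mf f0.
pose phi : R -> measurableTypeR R := fun x => a * x + b.
have mphi : measurable_fun [set: R] phi.
  by apply: measurable_funD => //; exact: measurable_funM.
have a_ge0 := ltW a0.
(* The right-hand measure gives every half-open interval its length, hence it is Lebesgue
   measure. *)
have E A : measurable A ->
    lebesgue_measure A =
    mscale (NngNum a_ge0) (pushforward (@lebesgue_measure R) phi) A.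
  move=> mA; apply: lebesgue_measure_unique => // _ [[p q] _ <-].
  transitivity (a%:E * lebesgue_measure (phi @^-1` `]p, q]))%E; last by [].
  have -> : phi @^-1` `]p, q] = `](p - b) / a, (q - b) / a]%classic.
    apply/seteqP; split => x; rewrite /phi /= !in_itv /=;
      by rewrite ltr_pdivrMr// ler_pdivlMr// ltrBlDr lerBrDr (mulrC x).
  rewrite !lebesgue_measure_itv /= !lte_fin ltr_pM2r ?invr_gt0// ltrD2r.
  case: ifPn => _; last by rewrite mule0.
  by rewrite -!EFinD -EFinM; congr EFin; field; rewrite gt_eqF.
rewrite [in RHS](eq_measure_integral
  (mscale (NngNum a_ge0) (pushforward (@lebesgue_measure R) phi))); last first.
  by move=> A mA _; exact: E.
rewrite ge0_integral_mscale// muleA -EFinM mulVf ?gt_eqF// mul1e.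
by rewrite ge0_integral_pushforward// preimage_setT.
Qed.

Lemma lebesgue_integral_opp (R : realType) (f : R -> \bar R) :
  measurable_fun [set: R] f -> (forall x, (0 <= f x)%E) ->
  (\int[@lebesgue_measure R]_x f (- x)%R = \int[@lebesgue_measure R]_x f x)%E.
Proof.
move=> mf f0; rewrite [RHS](eq_measure_integral
    (pushforward (@lebesgue_measure R) (-%R : _ -> measurableTypeR R))).
  by rewrite ge0_integral_pushforward// preimage_setT.
by move=> A mA _; exact/esym/lebesgue_measureN.
Qed.

Lemma lebesgue_integral_affine (R : realType) (a b : R) (f : R -> \bar R) :
  a != 0 -> measurable_fun [set: R] f -> (forall x, (0 <= f x)%E) ->
  (\int[@lebesgue_measure R]_x f (a * x + b)%R =
   (`|a|^-1)%:E * \int[@lebesgue_measure R]_x f x)%E.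
Proof.
move=> aN0 mf f0; have [a0|a0] : 0 < a \/ a < 0.
  by case: (ltgtP a 0) aN0 => // ? _; [right|left].
  by rewrite gtr0_norm// lebesgue_integral_affine_gt0.
rewrite ltr0_norm// -(lebesgue_integral_opp mf f0).
rewrite -(@lebesgue_integral_affine_gt0 _ (- a) (- b) (fun x => f (- x)))//.
- by apply: eq_integral => x _; congr f; ring.
- by rewrite oppr_gt0.
- by apply: measurableT_comp => //; exact: oppr_measurable.
Qed.

Lemma measurable_fun_comp_pair (R : realType) d (X : measurableType d)
    (f : R * R -> \bar R) (p q : X -> R) :
  measurable_fun [set: R * R] f ->
  measurable_fun [set: X] p -> measurable_fun [set: X] q ->
  measurable_fun [set: X] (fun x => f (p x, q x)).
Proof.
move=> mf mp mq.
by apply: (measurableT_comp (f := f) (g := fun x => (p x, q x))) => //;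
  exact: measurable_fun_pair.
Qed.

Lemma fubini_tonelli_plane (R : realType) (f : R * R -> \bar R) :
  measurable_fun [set: R * R] f -> (forall x, (0 <= f x)%E) ->
  (\int[@lebesgue_measure R \x @lebesgue_measure R]_z f z =
   \int[@lebesgue_measure R]_y \int[@lebesgue_measure R]_x f (x, y))%E.
Proof. by move=> mf f0; rewrite fubini_tonelli1// fubini_tonelli. Qed.

Lemma lebesgue_integral_swap (R : realType) (f : R * R -> \bar R) :
  measurable_fun [set: R * R] f -> (forall x, (0 <= f x)%E) ->
  (\int[@lebesgue_measure R]_y \int[@lebesgue_measure R]_x f (x, y) =
   \int[@lebesgue_measure R]_x \int[@lebesgue_measure R]_y f (x, y))%E.
Proof. by move=> mf f0; rewrite fubini_tonelli. Qed.

(** Iterated integration replaces one coordinate at a time. For [c != 0] the two one-dimensional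
    substitutions contribute the factors [|c|^-1] and [|c|], which cancel; for [c = 0] the motion
    exchanges the coordinates up to signs and translation. *)
Lemma lebesgue_integral_rigid_motion (R : realType) (c s b1 b2 : R)
    (f : R * R -> \bar R) :
  c ^+ 2 + s ^+ 2 = 1 ->
  measurable_fun [set: R * R] f -> (forall x, (0 <= f x)%E) ->
  (\int[@lebesgue_measure R \x @lebesgue_measure R]_z
     f (c * z.1 + s * z.2 + b1, - s * z.1 + c * z.2 + b2)%R =
   \int[@lebesgue_measure R \x @lebesgue_measure R]_z f z)%E.
Proof.
move=> cs1 mf f0.
have maff (k l m : R) :
    measurable_fun [set: R * R] (fun z => k * z.1 + l * z.2 + m).
  by apply: measurable_funD => //; apply: measurable_funD;
    exact: measurable_funM.
have maff1 (k m : R) : measurable_fun [set: R] (fun x => k * x + m).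
  by apply: measurable_funD => //; exact: measurable_funM.
rewrite !fubini_tonelli_plane//; last exact: measurable_fun_comp_pair.
have [c0|cN0] := eqVneq c 0.
  have s1 : `|s| = 1.
    move: cs1; rewrite c0 expr0n add0r => /eqP.
    by rewrite sqrf_eq1 => /orP[]/eqP ->; rewrite ?normrN normr1.
  have sN0 : s != 0 by rewrite -normr_gt0 s1.
  transitivity (\int[@lebesgue_measure R]_y
      \int[@lebesgue_measure R]_x f (s * y + b1, x)%R)%E.
    apply: eq_integral => y _ /=.
    have := @lebesgue_integral_affine _ (- s) b2 (fun x => f (s * y + b1, x)).
    rewrite normrN s1 invr1 mul1e => <-//; last 2 first.
    - by rewrite oppr_eq0.
    - exact: measurable_fun_comp_pair.
    by apply: eq_integral => x _; rewrite c0 !mul0r add0r addr0.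
  rewrite (lebesgue_integral_swap (f := fun z => f (s * z.2 + b1, z.1)))//;
    last first.
    apply: measurable_fun_comp_pair => //.
    by apply: measurable_funD => //; exact: measurable_funM.
  apply: eq_integral => x _ /=.
  have := @lebesgue_integral_affine _ s b1 (fun y => f (y, x)).
  rewrite s1 invr1 mul1e => ->//.
  exact: measurable_fun_comp_pair.
(* Eliminating x in favour of X = c x + s y + b1 turns the second coordinate into this one, because
   (1 - s^2) / c = c. *)
pose F z := f (z.1, c^-1 * z.2 + (b2 + s * (b1 - z.1) / c)).
have mF : measurable_fun setT F.
  apply: measurable_fun_comp_pair => //.
  rewrite (_ : (fun z => _) =
    fun z => - (s / c) * z.1 + c^-1 * z.2 + (b2 + s * b1 / c)).
    exact: maff.
  by apply/funext => z; ring.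
transitivity (\int[@lebesgue_measure R]_y ((`|c|^-1)%:E *
    \int[@lebesgue_measure R]_x F (x, y)))%E.
  apply: eq_integral => y _ /=.
  rewrite -(@lebesgue_integral_affine _ c (s * y + b1) (fun x => F (x, y)))//.
    apply: eq_integral => x _; rewrite /F/=; congr (f (_, _)).
      by rewrite addrA.
    by rewrite -[c^-1 * y]mul1r -cs1; field.
  - exact: measurable_fun_comp_pair.
  - by move=> x; exact: f0.
have mG : measurable_fun [set: R]
    (fun y => \int[@lebesgue_measure R]_x F (x, y))%E.
  have F0 z : (0 <= F z)%E by exact: f0.
  exact: (@measurable_fun_fubini_tonelli_G _ _ _ _ R (@lebesgue_measure R) F).
rewrite [LHS](ge0_integralZl lebesgue_measure measurableT mG); last 2 first.
- by move=> y _; apply: integral_ge0 => x _; exact: f0.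
- by rewrite lee_fin invr_ge0.
have F0 z : (0 <= F z)%E by exact: f0.
rewrite (lebesgue_integral_swap mF F0).
transitivity (`|c|^-1%:E * \int[@lebesgue_measure R]_x (`|c|%:E *
    \int[@lebesgue_measure R]_y f (x, y)))%E.
  congr (_ * _)%E; apply: eq_integral => x _.
  have mx : measurable_fun [set: R] (fun y => f (x, y)).
    exact: measurable_fun_comp_pair.
  have cV : c^-1 != 0 by rewrite invr_eq0.
  have := lebesgue_integral_affine (b2 + s * (b1 - x) / c) cV mx (fun=> f0 _).
  rewrite normrV ?unitfE// invrK => h.
  exact: h.
have mH : measurable_fun [set: R]
    (fun x => \int[@lebesgue_measure R]_y f (x, y))%E.
  exact: (@measurable_fun_fubini_tonelli_F _ _ _ _ R (@lebesgue_measure R) f).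
rewrite [X in (_ * X)%E](ge0_integralZl lebesgue_measure measurableT mH)//;
  last first.
- by move=> x _; apply: integral_ge0 => y _; exact: f0.
by rewrite muleA -EFinM mulVf ?normr_eq0// mul1e [RHS](lebesgue_integral_swap
  mf f0).
Qed.

(** * Area of a disc *)

(** The substitution y = sqrt(s) sin t leads to 2 s cos^2 t on [-pi/2, pi/2], whose primitive is s
    (t + sin t cos t). *)
Lemma integral_disc_chord (R : realType) (s : R) : 0 < s ->
  (\int[@lebesgue_measure R]_(y in `[(- Num.sqrt s)%R, Num.sqrt s])
     (2 * Num.sqrt (s - y ^+ 2))%:E = (pi * s)%:E)%E.
Proof.
move=> s0; have pi0 := pi_gt0 R.
have ss : Num.sqrt s ^+ 2 = s by rewrite sqr_sqrtr// ltW.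
pose F (t : R) : R := Num.sqrt s * sin t.
have dF : F^`()%classic = fun t => Num.sqrt s * cos t.
  by apply/funext => t; rewrite derive1E derive_val.
have derc (f : R -> R) : (forall t, derivable f t 1) -> continuous f.
  by move=> df t; exact/differentiable_continuous/derivable1_diffP/df.
have cF : continuous F by apply: derc => t; exact: ex_derive.
have cdF : continuous F^`()%classic.
  by rewrite dF; apply: derc => t; exact: ex_derive.
have pi2 : - (pi / 2) <= (pi / 2 : R) by lra.
rewrite (_ : - Num.sqrt s = F (- (pi / 2))); last first.
  by rewrite /F sinN sin_pihalf mulrN1.
rewrite [in X in `[_, X]](_ : Num.sqrt s = F (pi / 2)); last first.
  by rewrite /F sin_pihalf mulr1.
rewrite integration_by_substitution_increasing//; first last.
- apply: continuous_subspaceT => y.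
  apply: cvgM; first exact: cvg_cst.
  apply: (@continuous_comp _ _ _ (fun y : R => s - y ^+ 2) Num.sqrt).
    by apply: derc => t; exact: ex_derive.
  exact: sqrt_continuous.
- split=> [x _||]; first exact: ex_derive.
  + by apply: cvg_at_right_filter; exact: cF.
  + by apply: cvg_at_left_filter; exact: cF.
- apply/cvg_ex; exists (F^`()%classic (pi / 2)).
  by apply: cvg_at_left_filter; exact: cdF.
- apply/cvg_ex; exists (F^`()%classic (- (pi / 2))).
  by apply: cvg_at_right_filter; exact: cdF.
- move=> x y xI yI xy; rewrite /F ltr_pM2l ?sqrtr_gt0//.
  by rewrite ltr_sin.
pose H (t : R) : R := s * (t + sin t * cos t).
have cH : continuous H by apply: derc => t; exact: ex_derive.
transitivity (\int[@lebesgue_measure R]_(t in `[(- (pi / 2))%R, (pi / 2)%R])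
    (2 * s * cos t ^+ 2)%:E)%E.
  apply: eq_integral => t /[!inE] tI; congr EFin; rewrite dF.
  rewrite -[LHS]/(2 * Num.sqrt (s - (Num.sqrt s * sin t) ^+ 2) *
    (Num.sqrt s * cos t)).
  rewrite exprMn ss (_ : s - s * sin t ^+ 2 = s * cos t ^+ 2); last first.
    by rewrite -[s in s - _]mulr1 -(cos2Dsin2 t); ring.
  rewrite sqrtrM ?ltW// sqrtr_sqr ger0_norm; last exact: cos_ge0_pihalf.
  by rewrite -[in RHS]ss; ring.
rewrite (@continuous_FTC2 _ (fun t => 2 * s * cos t ^+ 2) H).
- rewrite -EFinB /H cosN cos_pihalf; congr EFin. by field.
- lra.
- by apply: continuous_subspaceT; apply: derc => t; exact: ex_derive.
- split=> [x _||]; first exact: ex_derive.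
  + by apply: cvg_at_right_filter; exact: cH.
  + by apply: cvg_at_left_filter; exact: cH.
- move=> t _; rewrite derive1E derive_val /=.
  by rewrite -[X in X + _](cos2Dsin2 t) /GRing.scale /=; ring.
Qed.

Definition sqdist (R : realType) (w x : R * R) : R :=
  (x.1 - w.1) ^+ 2 + (x.2 - w.2) ^+ 2.

(** The parameter is the squared radius: the area is then linear in [s], and annuli of equal width
    in [s] have equal area. *)
Definition disc (R : realType) (w : R * R) (s : R) : set (R * R) :=
  [set x | sqdist w x < s].

Lemma sqdist_ge0 (R : realType) (w x : R * R) : 0 <= sqdist w x.
Proof. by rewrite addr_ge0// sqr_ge0. Qed.

Lemma measurable_sqdist (R : realType) (w : R * R) :
  measurable_fun [set: R * R] (sqdist w).
Proof.
by apply: measurable_funD; apply: measurable_funX; exact: measurable_funB.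
Qed.

Lemma measurable_sublevel d (T : measurableType d) (R : realType) (f : T -> R)
  (s : R) :
  measurable_fun [set: T] f -> measurable [set x | f x < s].
Proof.
move=> mf; rewrite [X in measurable X](_ : _ = f @^-1` `]-oo, s[).
  by rewrite -[X in measurable X]setTI; exact: mf.
by apply/seteqP; split => x /=; rewrite in_itv.
Qed.

Lemma measurable_disc (R : realType) (w : R * R) (s : R) :
  measurable (disc w s).
Proof. exact: measurable_sublevel (measurable_sqdist w). Qed.

Lemma area_disc (R : realType) (w : R * R) (s : R) :
  0 <= s -> area (disc w s) = (pi * s)%:E.
Proof.
rewrite le_eqVlt => /predU1P[<-|s0].
  rewrite mulr0 (_ : disc w 0 = set0) ?/area ?measure0//.
  by apply/seteqP; split => // x /=; rewrite /disc/= ltNge sqdist_ge0.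
(* As [Num.sqrt] is 0 at negative numbers, [G] is the length of the vertical section at horizontal
   distance [x] from the centre, whether or not the section is empty. *)
pose G (x : R) : \bar R := (2 * Num.sqrt (s - x ^+ 2))%:E.
have mG : measurable_fun [set: R] G.
  apply/measurable_EFinP; apply: measurable_funM => //.
  apply: (measurableT_comp (f := @Num.sqrt R) (g := fun x : R => s - x ^+ 2)).
    by apply: continuous_measurable_fun; exact: sqrt_continuous.
  by apply: measurable_funB => //; exact: measurable_funX.
have G0 x : (0 <= G x)%E by rewrite lee_fin mulr_ge0// sqrtr_ge0.
transitivity (\int[@lebesgue_measure R]_x G (1 * x + - w.1)%R)%E.
  apply: eq_integral => x _ /=; rewrite mul1r /G.
  set q := s - (x - w.1) ^+ 2.
  have -> : xsection (disc w s) x =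
      `]w.2 - Num.sqrt q, w.2 + Num.sqrt q[%classic.
    apply/seteqP; split => y;
      rewrite /xsection /= inE /disc /sqdist /= in_itv /=.
      rewrite addrC -ltrBrDr -/q => yq.
      rewrite -ltr_distlC distrC -sqrtr_sqr ltr_sqrt//.
      by apply: le_lt_trans yq; exact: sqr_ge0.
    rewrite -ltr_distlC distrC => h.
    rewrite addrC -ltrBrDr -/q.
    have q0 : 0 < q by rewrite -sqrtr_gt0; exact: le_lt_trans h.
    by rewrite -ltr_sqrt// sqrtr_sqr.
  rewrite lebesgue_measure_itv /= lte_fin.
  case: ifPn => [_|]; first by rewrite -EFinB; congr EFin; ring.
  rewrite -leNgt => h; have := sqrtr_ge0 q => h'.
  have -> : Num.sqrt q = 0 by lra.
  by rewrite mulr0.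
rewrite lebesgue_integral_affine ?oner_eq0// normr1 invr1 mul1e.
rewrite -integral_disc_chord// [RHS]integral_mkcond.
apply: eq_integral => x _; rewrite patchE; case: ifPn => // /negP.
rewrite inE /= in_itv /= -ler_norml => /negP; rewrite -ltNge -sqrtr_sqr => h.
rewrite /G ler0_sqrtr ?mulr0// subr_le0.
by rewrite -ler_sqrt ?sqr_ge0// ltW.
Qed.

(** * Gaussian integrals *)

Section gaussian.
Variable R : realType.
Local Notation mu := (@lebesgue_measure R).

Lemma integral_gauss_scaled (a : R) : 0 < a ->
  (\int[mu]_x (expR (- a * x ^+ 2))%:E = (Num.sqrt pi / Num.sqrt a)%:E)%E.
Proof.
move=> a0; have sa0 : 0 < Num.sqrt a by rewrite sqrtr_gt0.
have mg : measurable_fun [set: R] (fun x : R => (gauss_fun x)%:E).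
by apply/measurable_EFinP; exact: measurable_gauss_fun.
have g0 (x : R) : (0 <= (gauss_fun x)%:E)%E by rewrite lee_fin gauss_fun_ge0.
have := lebesgue_integral_affine 0 (lt0r_neq0 sa0) mg g0.
rewrite integralT_gauss -EFinM mulrC gtr0_norm// => <-.
apply: eq_integral => x _; rewrite /gauss_fun addr0 exprMn.
by rewrite sqr_sqrtr ?ltW// mulNr.
Qed.

Lemma integral_gauss_tail (x : R) :
  (\int[mu]_(t in `[x, +oo[) (expR (- t ^+ 2))%:E =
   (\int[mu]_(t in `[x, +oo[) expR (- t ^+ 2))%:E)%E.
Proof.
rewrite /Rintegral fineK// ge0_fin_numE; last first.
  by apply: integral_ge0 => t _; rewrite lee_fin expR_ge0.
apply: (@le_lt_trans _ _ (\int[mu]_t (gauss_fun t)%:E)%E); last first.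
  by rewrite integralT_gauss ltry.
apply: ge0_subset_integral => //.
by apply/measurable_EFinP; exact: measurable_gauss_fun.
Qed.

(** The integrand is even, and for x >= 0 one has x^2 + 2 e x = (x + e)^2 - e^2; then t = sqrt(a) (x
    + e) gives the Gaussian tail. *)
Lemma integral_gauss_cusp (a e : R) : 0 < a -> 0 <= e ->
  (\int[mu]_x (expR (- a * (x ^+ 2 + 2 * e * `|x|)))%:E =
   (2 * expR (a * e ^+ 2) / Num.sqrt a *
     \int[mu]_(t in `[(Num.sqrt a * e)%R, +oo[) expR (- t ^+ 2))%:E)%E.
Proof.
move=> a0 e0; have sa0 : 0 < Num.sqrt a by rewrite sqrtr_gt0.
have saa : Num.sqrt a ^+ 2 = a by rewrite sqr_sqrtr ?ltW.
pose f (x : R) := (expR (- a * (x ^+ 2 + 2 * e * `|x|))).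
rewrite (@ge0_symfun_integralT _ f); last 3 first.
- by move=> x; exact: expR_ge0.
- - move=> x; apply: continuous_comp; last exact: continuous_expR.
  apply: cvgM; first exact: cvg_cst.
  apply: cvgD; first exact: exprn_continuous.
  by apply: cvgM; [exact: cvg_cst|exact: norm_continuous].
- by move=> x; rewrite /f /= normrN sqrrN.
rewrite (_ : [set x | 0 <= x] = `[0, +oo[%classic); last first.
  by apply/seteqP; split => x/=; rewrite in_itv/= andbT.
rewrite -!mulrA EFinM; congr (_ * _)%E.
(* Cutting the Gaussian off at the image of 0 turns the substitution on the half-line into one on
   the whole line. *)
pose h := (fun t : R => (expR (- t ^+ 2))%:E) \_ `[(Num.sqrt a * e)%R, +oo[.
have mh : measurable_fun [set: R] h.
  apply: (measurable_restrictT _ _).1 => //; apply/measurable_EFinP.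
  by apply: measurable_funTS; exact: measurable_gauss_fun.
have h0 (x : R) : (0 <= h x)%E.
  by rewrite /h patchE; case: ifPn => // _; rewrite lee_fin expR_ge0.
have := lebesgue_integral_affine (Num.sqrt a * e) (lt0r_neq0 sa0) mh h0.
rewrite -[X in _ = (_ * X)%E]integral_mkcond integral_gauss_tail => I.
rewrite EFinM EFinM -{1}(gtr0_norm sa0) -I.
have mh' : measurable_fun [set: R] (fun x =>
  h (Num.sqrt a * x + Num.sqrt a * e)).
  apply: (measurableT_comp (f := h)) => //.
  by apply: measurable_funD => //; exact: measurable_funM.
rewrite -(ge0_integralZl mu measurableT mh')//.
rewrite [LHS]integral_mkcond; apply: eq_integral => x _.
rewrite /h !patchE !mem_setE !in_itv /= !andbT lerDr.
rewrite pmulr_rge0//; case: ifPn => [x0|_]; last by rewrite mule0.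
rewrite -EFinM -expRD /f ger0_norm//; congr (expR _)%:E.
by rewrite -{1 2}saa; ring.
Qed.

Lemma integral_gauss_cusp_plane (a e : R) : 0 < a -> 0 <= e ->
  (\int[mu \x mu]_z
     (expR (- a * (z.1 ^+ 2 + z.2 ^+ 2 + 2 * e * `|z.1|)))%:E =
   (pi / a * (expR (a * e ^+ 2) * erfc (Num.sqrt a * e)))%:E)%E.
Proof.
move=> a0 e0; have saa : Num.sqrt a ^+ 2 = a by rewrite sqr_sqrtr ?ltW.
have pp : Num.sqrt (pi : R) ^+ 2 = pi by rewrite sqr_sqrtr ?pi_ge0.
have sa0 : 0 < Num.sqrt a by rewrite sqrtr_gt0.
have sp0 : 0 < Num.sqrt (pi : R) by rewrite sqrtr_gt0 pi_gt0.
have mexp : measurable_fun [set: R] (@expR R).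
  by apply: continuous_measurable_fun; exact: continuous_expR.
have mf1 : measurable_fun [set: R]
    (fun x : R => (expR (- a * (x ^+ 2 + 2 * e * `|x|)))%:E).
  apply/measurable_EFinP; apply: measurableT_comp => //.
  apply: measurable_funM => //; apply: measurable_funD => //.
  by apply: measurable_funM => //; exact: normr_measurable.
have mf2 : measurable_fun [set: R] (fun y : R => (expR (- a * y ^+ 2))%:E).
  apply/measurable_EFinP; apply: measurableT_comp => //.
  by apply: measurable_funM => //.
rewrite fubini_tonelli_plane; last 2 first.
- apply/measurable_EFinP; apply: measurableT_comp => //.
  apply: measurable_funM => //; apply: measurable_funD.
    by apply: measurable_funD; apply: measurable_funX.
  apply: measurable_funM => //.
  by apply: (measurableT_comp (f := @Num.norm R R) (g := fst)) => //;
    exact: normr_measurable.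
- by move=> z; rewrite lee_fin expR_ge0.
transitivity (\int[mu]_y ((2 * expR (a * e ^+ 2) / Num.sqrt a *
     \int[mu]_(t in `[(Num.sqrt a * e)%R, +oo[) expR (- t ^+ 2))%:E *
   (expR (- a * y ^+ 2))%:E))%E.
  apply: eq_integral => y _ /=.
  rewrite -integral_gauss_cusp//.
  rewrite -(ge0_integralZr mu measurableT mf1) ?lee_fin ?expR_ge0//.
  apply: eq_integral => x _; rewrite -EFinM -expRD.
  by congr (expR _)%:E; ring.
rewrite ge0_integralZl//; last first.
  rewrite lee_fin !mulr_ge0// ?expR_ge0 ?invr_ge0 ?sqrtr_ge0//.
  by apply: Rintegral_ge0 => x _; exact: expR_ge0.
rewrite integral_gauss_scaled// -EFinM /erfc; congr EFin.
rewrite -[in pi / a]pp -[in _ / a]saa; field.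
by rewrite !gt_eqF.
Qed.
End gaussian.

Lemma polar_coordinates (R : realType) (u : R * R) :
  exists c s : R, [/\ c ^+ 2 + s ^+ 2 = 1, u.1 = enorm u * c & u.2 = enorm u *
    s].
Proof.
have e2 : enorm u ^+ 2 = u.1 ^+ 2 + u.2 ^+ 2.
  by rewrite sqr_sqrtr// addr_ge0// sqr_ge0.
have [e0|eN0] := eqVneq (enorm u) 0.
  (* For [u = 0] any unit vector serves. *)
  exists 1, 0; move: e2; rewrite e0 expr0n /= => /esym/eqP.
  rewrite paddr_eq0 ?sqr_ge0// !sqrf_eq0 => /andP[/eqP -> /eqP ->].
  by split; ring.
exists (u.1 / enorm u), (u.2 / enorm u); split; last 2 first.
- by field.
- by field.
by rewrite !expr_div_n -mulrDl -e2 divff// expf_neq0.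
Qed.

(** For [u = xs - w] this is [shat xs xd x ^+ 2 - enorm u ^+ 2]: the foci are w + u and w - u, and
    the larger of |v - u|^2 and |v + u|^2, with v = x - w, is |u|^2 + |v|^2 + 2 |u . v|. *)
Definition cusp (R : realType) (w u x : R * R) : R :=
  sqdist w x + 2 * `|u.1 * (x.1 - w.1) + u.2 * (x.2 - w.2)|.

Lemma measurable_cusp (R : realType) (w u : R * R) :
  measurable_fun [set: R * R] (cusp w u).
Proof.
apply: measurable_funD; first exact: measurable_sqdist.
apply: measurable_funM => //.
apply: (measurableT_comp (f := @Num.norm R R)
  (g := fun x : R * R => u.1 * (x.1 - w.1) + u.2 * (x.2 - w.2))).
  exact: normr_measurable.
by apply: measurable_funD; apply: measurable_funM => //;
  exact: measurable_funB.
Qed.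

(* Rotating the plane so that [u] becomes horizontal separates the variables. *)
Lemma integral_cusp (R : realType) (w u : R * R) (a : R) : 0 < a ->
  (\int[@lebesgue_measure R \x @lebesgue_measure R]_z
     (expR (- a * cusp w u z))%:E =
   (pi / a * (expR (a * enorm u ^+ 2) * erfc (Num.sqrt a * enorm u)))%:E)%E.
Proof.
move=> a0; have [c [s [cs1 u1 u2]]] := polar_coordinates u.
have e0 : 0 <= enorm u by exact: sqrtr_ge0.
pose f (z : R * R) : \bar R :=
  (expR (- a * (z.1 ^+ 2 + z.2 ^+ 2 + 2 * enorm u * `|z.1|)))%:E.
have mf : measurable_fun [set: R * R] f.
  apply/measurable_EFinP; apply: measurableT_comp.
    by apply: continuous_measurable_fun; exact: continuous_expR.
  apply: measurable_funM => //; apply: measurable_funD.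
    by apply: measurable_funD; apply: measurable_funX.
  apply: measurable_funM => //.
  by apply: (measurableT_comp (f := @Num.norm R R) (g := fst)) => //;
    exact: normr_measurable.
have f0 z : (0 <= f z)%E by rewrite lee_fin expR_ge0.
have E (x y : R) : (x - w.1) ^+ 2 + (y - w.2) ^+ 2 +
    2 * `|enorm u * c * (x - w.1) + enorm u * s * (y - w.2)| =
    (c * x + s * y + - (c * w.1 + s * w.2)) ^+ 2 +
    (- s * x + c * y + (s * w.1 - c * w.2)) ^+ 2 +
    2 * enorm u * `|c * x + s * y + - (c * w.1 + s * w.2)|.
  rewrite (_ : enorm u * c * (x - w.1) + enorm u * s * (y - w.2) =
    enorm u * (c * x + s * y + - (c * w.1 + s * w.2))); last by ring.
  rewrite normrM (ger0_norm e0) mulrA -[_ ^+ 2 + (y - _) ^+ 2]mul1r -cs1.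
  by ring.
rewrite -(integral_gauss_cusp_plane a0 e0).
rewrite -(lebesgue_integral_rigid_motion (- (c * w.1 + s * w.2))
  (s * w.1 - c * w.2) cs1 mf f0).
by apply: eq_integral => z _; rewrite /f /cusp /sqdist u1 u2 E.
Qed.

(** * Nearest points of a locally finite set *)

Section nearest_points.
Variable R : realType.
Implicit Types (S A : set (R * R)) (w x y : R * R).

Definition is_nearest w S x : Prop :=
  S x /\ forall y, S y -> y <> x -> sqdist w x < sqdist w y.

Definition locally_finite S : Prop :=
  forall A, bounded_set A -> finite_set (S `&` A).

Definition singleton S : Prop := exists x, S = [set x].

Lemma enormB w x : enorm (x - w) = Num.sqrt (sqdist w x).
Proof. by []. Qed.

Lemma sqrt_sqdist_lt w x y :
  (Num.sqrt (sqdist w x) < Num.sqrt (sqdist w y)) = (sqdist w x < sqdist w y).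
Proof.
have [y0|] := ltP 0 (sqdist w y); first exact: ltr_sqrt.
move=> y0; have -> : sqdist w y = 0 by apply/le_anti; rewrite y0 sqdist_ge0.
by rewrite sqrtr0 !ltNge sqrtr_ge0 sqdist_ge0.
Qed.

Lemma is_nearest_uniq w S x y : is_nearest w S x -> is_nearest w S y -> y = x.
Proof.
move=> [Sx xP] [Sy yP]; apply: contrapT => yx.
have := lt_trans (xP _ Sy yx) (yP _ Sx (nesym yx)).
by rewrite ltxx.
Qed.

Lemma nearestE w S x : is_nearest w S x -> nearest S w = x.
Proof.
move=> [Sx xP]; apply: xget_unique => [|y [Sy yP]].
  by split=> // y Sy yx; rewrite !enormB sqrt_sqdist_lt; exact: xP.
apply: (@is_nearest_uniq w S x y) => //; split=> // z Sz zy.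
by have := yP _ Sz zy; rewrite !enormB sqrt_sqdist_lt.
Qed.

Lemma nearestN w S : ~ (exists x, is_nearest w S x) -> nearest S w = w.
Proof.
move=> h; apply: xgetPN => x [Sx xP]; apply: h; exists x; split=> // y Sy yx.
by have := xP _ Sy yx; rewrite !enormB sqrt_sqdist_lt.
Qed.

(** Leaves room for a rational squared radius between the nearest point and the others. *)
Lemma finite_set_gap (T : eqType) (F : set T) (f : T -> R) (r : R) :
  finite_set F -> (forall v : T, F v -> r < f v) ->
  exists2 t, r < t & forall v : T, F v -> t <= f v.
Proof.
move=> /finite_seqP[s ->]; elim: s => [|z s IH] h.
  by exists (r + 1) => //; rewrite ltrDl.
have [v vs|t rt ts] := IH; first by apply: h; rewrite /= inE vs orbT.
exists (Num.min t (f z)).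
  by rewrite lt_min rt h//= inE eqxx.
move=> v; rewrite /= inE => /predU1P[->|vs]; first by rewrite ge_min lexx orbT.
by rewrite ge_min ts.
Qed.

Lemma bounded_disc w (s : R) : bounded_set (disc w s).
Proof.
exists (Num.sqrt s + (`|w.1| + `|w.2|)); split; first exact: num_real.
move=> M ltM x xs /=; apply: ltW; apply: le_lt_trans ltM.
have h (q : R) : q ^+ 2 <= sqdist w x -> `|q| <= Num.sqrt s.
  by move=> qx; rewrite -sqrtr_sqr ler_wsqrtr// (le_trans qx)// ltW.
rewrite prod_normE ge_max; apply/andP; split.
  rewrite -(subrK w.1 x.1) (le_trans (ler_normD _ _))// lerD ?lerDl//.
  by apply: h; rewrite /sqdist lerDl sqr_ge0.
rewrite -(subrK w.2 x.2) (le_trans (ler_normD _ _))// lerD ?lerDr//.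
by apply: h; rewrite /sqdist lerDr sqr_ge0.
Qed.

Lemma locally_finiteS S A : A `<=` S -> locally_finite S -> locally_finite A.
Proof.
move=> AS Slf B bB; apply: sub_finite_set (Slf _ bB).
exact: setSI.
Qed.

Lemma finite_set_min (T : eqType) (F : set T) (f : T -> R) :
  finite_set F -> F !=set0 -> exists2 v, F v & forall v', F v' -> f v <= f v'.
Proof.
move=> /finite_seqP[s ->]; case: s => [[]//|z s] _.
elim: s z => [z|z' s IH z].
  by exists z => [|v]; rewrite /= inE// => /eqP ->.
have [v /= vs vP] := IH z'; have [vz|zv] := leP (f v) (f z).
  exists v; first by rewrite /= inE vs orbT.
  by move=> t; rewrite /= inE => /predU1P[->//|]; exact: vP.
exists z; first by rewrite /= inE eqxx.
move=> t; rewrite /= inE => /predU1P[->//|/vP]; exact/le_trans/ltW.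
Qed.

Lemma exists_closest w S : locally_finite S -> S !=set0 ->
  exists2 x, S x & forall y, S y -> sqdist w x <= sqdist w y.
Proof.
move=> Slf [x0 Sx0].
(* Local finiteness applies to bounded sets only; the added 1 puts [x0] inside the open disc. *)
have x0d : disc w (sqdist w x0 + 1) x0 by rewrite /disc /= ltrDl.
have [|x [Sx xd] xP] := finite_set_min (sqdist w)
    (Slf _ (bounded_disc w (sqdist w x0 + 1))).
  by exists x0.
exists x => // y Sy.
have [yd|] := ltP (sqdist w y) (sqdist w x0 + 1); last exact/le_trans/ltW.
by apply: xP.
Qed.

Lemma disc_is_nearest w S (t : R) x :
  S `&` disc w t = [set x] -> is_nearest w S x.
Proof.
move=> E; have [Sx xt] : (S `&` disc w t) x by rewrite E.
split=> // y Sy yx; apply: lt_le_trans xt _; rewrite leNgt; apply/negP => yt.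
by apply: yx; have : (S `&` disc w t) y by []; rewrite E.
Qed.

(** Together with [disc_is_nearest], this makes the existence of a nearest point a countable
    condition on counts in discs. *)
Lemma is_nearest_disc w S x : locally_finite S -> is_nearest w S x ->
  exists q : rat, S `&` disc w (ratr q) = [set x].
Proof.
move=> Slf [Sx xP].
have [|y [[Sy _] yx]|t xt tP] := @finite_set_gap _
    ((S `&` disc w (sqdist w x + 1)) `\ x) (sqdist w) (sqdist w x).
- exact/finite_setD/Slf/bounded_disc.
- exact: xP.
(* The gap [t] concerns only the points of the disc of squared radius [sqdist w x + 1], so [q] must
   also stay below that value. *)
have : sqdist w x < Num.min t (sqdist w x + 1) by rewrite lt_min xt ltrDl ltr01.
move=> /rat_in_itvoo[q]; rewrite in_itv /= lt_min => /and3P[xq qt qx].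
exists q; apply/seteqP; split => [y [Sy yq]|y ->]; last by split.
apply: contrapT => yx.
have : t <= sqdist w y.
  by apply: tP; split=> //; split=> //; exact: lt_trans yq qx.
by rewrite leNgt (lt_trans yq qt).
Qed.

Variables (w : R * R) (g : R * R -> R).
Hypothesis sqdist_g : forall x, sqdist w x <= g x.

(* When all distances to [w] differ, the point [z] on the right can only be the
   nearest one, since [sqdist w z <= g z]. *)
Lemma generic_nearest S x y : locally_finite S ->
  S x -> S y -> x <> y ->
  (forall x y, S x -> S y -> sqdist w x = sqdist w y -> x = y) ->
  (g (nearest S w) <= sqdist w (second_nearest S w) <->
   exists2 z, S z & forall t, S t -> t <> z -> g z <= sqdist w t).
Proof.
move=> Slf Sx Sy xy Sinj.
have near A : A `<=` S -> A !=set0 -> exists z, is_nearest w A z.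
  move=> AS A0; have [z Az zP] := exists_closest w (locally_finiteS AS Slf) A0.
  exists z; split=> // t At tz; rewrite lt_neqAle zP// andbT.
  by apply/eqP => e; apply: tz; apply: Sinj => //; exact: AS.
have [x1 x1P] : exists z, is_nearest w S z by apply: near => //; exists x.
have [x2 x2P] : exists z, is_nearest w (S `\ x1) z.
  apply: near; first exact: subDsetl.
  have [xx1|] := pselect (x = x1); last by exists x.
  by exists y; split=> //; rewrite -xx1; exact: nesym.
rewrite /second_nearest (nearestE x1P) (nearestE x2P).
split=> [h|[z Sz zP]].
  exists x1 => [|t St tx1]; first exact: x1P.1.
  have [->//|/eqP tx2] := eqVneq t x2.
  by apply: le_trans h (ltW _); apply: x2P.2.
have zx1 : z = x1.
  apply: contrapT => zx1.
  have := lt_le_trans (x1P.2 _ Sz zx1) (sqdist_g z).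
  by rewrite ltNge zP//; [exact: x1P.1|exact: nesym].
by move: x2P => [[Sx2 x2x1] _]; rewrite -zx1; apply: zP => //; rewrite zx1.
Qed.

Hypothesis gw : g w = 0.

(* [P] is not assumed complete, so the event must be measurable including its
   junk cases: [nearest] or [second_nearest] is [w] when it does not exist or is
   not unique. The first disjunct says that there is no unique nearest point;
   under it or [S w] the inequality reads [0 <= _]. In the third, the first
   component says that the second nearest point is unique, and [s] is a rational
   between [sqdist w (second_nearest S w)] and [g (nearest S w)]. *)
Lemma suff_countable S : locally_finite S ->
  (g (nearest S w) <= sqdist w (second_nearest S w) <->
   [\/ forall q : rat, ~ singleton (S `&` disc w (ratr q)),
       S w |
       (exists (q : rat) x y,
          x <> y /\ S `&` disc w (ratr q) = [set x; y]) /\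
       forall q s : rat, ~ [/\ singleton (S `&` disc w (ratr q)),
         singleton (S `&` (disc w (ratr q) `&` [set x | ratr s < g x])),
         S `&` disc w (ratr s) <> set0 &
         ~ singleton (S `&` disc w (ratr s))]]).
Proof.
move=> Slf.
have [[x1 x1P]|none] := pselect (exists x, is_nearest w S x); last first.
  split=> _; last by rewrite nearestN// gw sqdist_ge0.
  apply: Or31 => q [x xE]; apply: none; exists x; exact: disc_is_nearest xE.
rewrite /second_nearest (nearestE x1P).
have [q1 q1E] := is_nearest_disc Slf x1P.
have Slf1 : locally_finite (S `\ x1) by apply: locally_finiteS Slf => ? [].
have gx1 : sqdist w x1 <= g x1 := sqdist_g x1.
have [wx1|wx1] := pselect (x1 = w).
  split=> _; first by apply: Or32; rewrite -wx1; exact: x1P.1.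
  by rewrite wx1 gw sqdist_ge0.
have NSw : ~ S w.
  move=> Sw; have := x1P.2 _ Sw (nesym wx1).
  rewrite {2}/sqdist !subrr expr0n /= addr0 ltNge sqdist_ge0//.
have g1_gt0 : 0 < g x1.
  apply: lt_le_trans gx1; rewrite lt_neqAle sqdist_ge0 andbT.
  apply/eqP => /esym/eqP; rewrite paddr_eq0 ?sqr_ge0// !sqrf_eq0 !subr_eq0.
  move=> /andP[/eqP e1 /eqP e2]; apply: wx1.
  by case: (x1) (w) e1 e2 => [? ?] [? ?] /= -> ->.
have [[x2 x2P]|none] := pselect (exists x, is_nearest w (S `\ x1) x);
  last first.
  rewrite nearestN//; split=> [|[|//|[[q [x [y [xy E]]]] _]]].
  - rewrite /sqdist !subrr expr0n /= addr0 => h.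
    by move: g1_gt0; rewrite ltNge h.
  - by move=> /(_ q1); case; exists x1.
  - have [Sx xq] : (S `&` disc w (ratr q)) x by rewrite E; left.
    have [Sy yq] : (S `&` disc w (ratr q)) y by rewrite E; right.
    have x1q : [set x; y] x1.
      rewrite -E; split; first exact: x1P.1.
      have [<-//|/eqP xx1] := eqVneq x x1.
      exact: lt_trans (x1P.2 _ Sx xx1) xq.
    exfalso; apply: none.
    (* One of the two points of the disc is [x1]; with [x1] removed the other is alone there, hence
       nearest in the rest of [S], against [none]. *)
    have sub z : z <> x1 -> [set x; y] = [set x1;
      z] -> exists t, is_nearest w (S `\ x1) t.
      move=> zx1 Ez; exists z; apply: (@disc_is_nearest _ _ (ratr q)).
      rewrite setIDAC setIDA E Ez; apply/seteqP;
        split => [t [[->|->//] /(_ erefl)//]|t ->].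
      by split=> //; right.
    case: x1q => [x1x|x1y].
      by apply: (sub y); rewrite x1x//; exact: nesym.
    by apply: (sub x); rewrite x1y// setUC.
rewrite (nearestE x2P); have [[Sx2 x2x1] x2min] := x2P.
have x12 := x1P.2 _ Sx2 x2x1.
split=> [h|[|//|[_ h]]].
- apply: Or33; split.
    have [q2 q2E] := is_nearest_disc Slf1 x2P.
    exists q2, x1, x2; split; first exact: nesym.
    have x2q : disc w (ratr q2) x2.
      have : [set x2] x2 by [].
      by rewrite -q2E => -[].
    apply/seteqP; split => [t [St tq]|t [->|->]].
    + have [->|tx1] := pselect (t = x1); first by left.
      right.
      by rewrite -q2E; split.
    + by split; [exact: x1P.1|exact: lt_trans x2q].
    + by split.
  move=> q s [[z zE] [z' z'E] s0 s1].
  have zx1 : z = x1 by apply: is_nearest_uniq x1P _; exact: disc_is_nearest zE.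
  have [Sz' [z'q gs]] :
      (S `&` (disc w (ratr q) `&` [set x | ratr s < g x])) z' by rewrite z'E.
  have z'x1 : z' = x1.
    have : (S `&` disc w (ratr q)) z' by [].
    by rewrite zE zx1.
  (* The disc of squared radius [s] holds neither zero points nor one, so some point other than [x1]
     lies in it. This bounds the second smallest squared distance by [s], hence strictly below
     [g x1], against [h]. *)
  have [y [Sy yx1 ys]] : exists y, [/\ S y, y <> x1 & disc w (ratr s) y].
    have /set0P[t [St ts]] := introN eqP s0.
    have [tx1|] := pselect (t = x1); last by exists t.
    apply: contrapT => hy; apply: s1; exists x1.
    apply/seteqP; split => [t' [St' t's]|t' ->]; last by rewrite -tx1; split.
    by apply: contrapT => t'x1; apply: hy; exists t'.
  have : sqdist w x2 <= sqdist w y.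
    have [->//|/eqP yx2] := eqVneq y x2.
    by apply: ltW; apply: x2min.
  rewrite leNgt (lt_le_trans ys)//.
  by rewrite (le_trans (ltW gs))// z'x1.
- by move=> /(_ q1); case; exists x1.
(* If the inequality fails, a rational [s] fits strictly between its two sides; the disc of squared
   radius [s] then contains both [x1] and [x2]. *)
rewrite leNgt; apply/negP => /rat_in_itvoo[s];
  rewrite in_itv /= => /andP[x2s sg].
apply: (h q1 s); split; first by exists x1.
- exists x1; rewrite setIA q1E; apply/seteqP; split => [t [->]//|t ->].
  by split.
- by move=> /seteqP[/(_ x2) + _]; apply.
- move=> [z zE]; apply: x2x1.
  have -> : x2 = z by have : (S `&` disc w (ratr s)) x2 by []; rewrite zE.
  have : (S `&` disc w (ratr s)) x1 by split;
    [exact: x1P.1|exact: lt_trans x2s].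
  by rewrite zE.
Qed.

End nearest_points.

Lemma sub_bounded_set (R : realType) (A B : set (R * R)) :
  A `<=` B -> bounded_set B -> bounded_set A.
Proof.
move=> AB [M [Mr BM]]; exists M; split=> // M' /BM bM x /AB; exact: bM.
Qed.

(** * Poisson counts *)

Lemma counting_card (T : choiceType) (R : realType) (A : set T) (k : nat) :
  counting A = k%:R%:E :> \bar R <-> (A #= `I_k)%card.
Proof.
rewrite /counting; split.
  case: ifPn => // /asboolP [n An] [] /eqP; rewrite eqr_nat => /eqP kE.
  by rewrite -kE (card_fset_set An).
move=> Ak; rewrite asboolT; first by rewrite (card_fset_set Ak).
by exists k.
Qed.

Section levels.
Variables (T : Type) (R : realType) (f : T -> R) (h : R).
Hypothesis h0 : 0 < h.

Definition level (k : nat) : set T := [set x | k%:R * h <= f x < k.+1%:R * h].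

Lemma exists_level x : 0 <= f x -> exists k, level k x.
Proof.
move=> fx0; exists (Num.truncn (f x / h)).
have fh0 : 0 <= f x / h by rewrite divr_ge0// ltW.
by rewrite /level /= -ler_pdivlMr// -ltr_pdivrMr// truncn_le fh0 truncnS_gt.
Qed.

Lemma level_inj k j x : level k x -> level j x -> k = j.
Proof.
wlog kj : k j / (k <= j)%N.
  by move=> H kx jx; case/orP: (leq_total k j) => ?; [|apply/esym]; exact: H.
rewrite /level /= => /andP[_ xk] /andP[jx _].
have := le_lt_trans jx xk; rewrite ltr_pM2r// ltr_nat ltnS => jk.
by apply/eqP; rewrite eqn_leq kj.
Qed.

Lemma trivIset_level : trivIset setT level.
Proof. by move=> k j _ _ [x [kx jx]]; exact: level_inj kx jx. Qed.

Lemma bigcup_level : (forall x, 0 <= f x) -> \bigcup_k level k = setT.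
Proof.
by move=> f0; apply/seteqP; split=> // x _; have [k] := exists_level (f0 x);
  exists k.
Qed.

End levels.

Lemma measurable_level d (T : measurableType d) (R : realType) (f : T -> R)
    (h : R) (k : nat) :
  measurable_fun [set: T] f -> measurable (level f h k).
Proof.
move=> mf; rewrite (_ : level f h k = [set x | f x < k.+1%:R * h] `\`
  [set x | f x < k%:R * h]).
  by apply: measurableD; exact: measurable_sublevel.
apply/seteqP; split=> [x /andP[kx xk]|x [/= xk /negP]].
  by split=> //=; apply/negP; rewrite -leNgt.
by rewrite -leNgt /level /= => ->.
Qed.

Lemma level_disc (R : realType) w (g : R * R -> R) h k :
  (forall x, sqdist w x <= g x) -> level g h k `<=` disc w (k.+1%:R * h).
Proof. by move=> wg x /andP[_]; exact: le_lt_trans. Qed.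

Lemma area_fin (R : realType) (A : set (R * R)) :
  measurable A -> bounded_set A -> area A \is a fin_num.
Proof.
move=> mA [M [_ bA]]; rewrite ge0_fin_numE ?measure_ge0//.
have [s As] : exists s : R, A `<=` disc 0 s /\ 0 <= s.
  have M1 : M < `|M| + 1 by rewrite (le_lt_trans (ler_norm _))// ltrDl.
  (* [bounded_set] bounds the max norm, so each squared coordinate is at most [(|M| + 1) ^+ 2]; the
     final 1 makes the inequality strict. *)
  exists (2 * (`|M| + 1) ^+ 2 + 1); split; last first.
    by rewrite addr_ge0// mulr_ge0// sqr_ge0.
  move=> x /(bA _ M1) /=; rewrite prod_normE ge_max => /andP[x1 x2].
  have sq (t : R) : `|t| <= `|M| + 1 -> t ^+ 2 <= (`|M| + 1) ^+ 2.
    by move=> tM; rewrite -real_normK ?num_real// lerXn2r// nnegrE// addr_ge0.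
  rewrite /disc /sqdist /= !subr0 (_ : 2 * _ = (`|M| + 1) ^+ 2 + (`|M| + 1) ^+
    2).
    by rewrite ltr_pwDr// lerD// sq.
  by ring.
have [As1 s0] := As.
apply: (@le_lt_trans _ _ (area (disc 0 s))); last by rewrite area_disc// ltry.
by apply: le_measure => //; rewrite inE//; exact: measurable_disc.
Qed.

Definition real_area (R : realType) (A : set (R * R)) : R := fine (area A).

Section poisson.
Context {d : measure_display} {T : measurableType d} {R : realType}.
Variables (P : probability T R) (lam : R) (Phi : T -> set (R * R)).
Hypothesis lam0 : 0 < lam.
Hypothesis PhiP : homogeneous_poisson P lam Phi.
Implicit Types A B C D : set (R * R).

Lemma count_eventP A k omega :
  count_event Phi A k omega <-> (Phi omega `&` A #= `I_k)%card.
Proof. exact: counting_card. Qed.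

Lemma count_event0 A omega :
  count_event Phi A 0 omega <-> Phi omega `&` A = set0.
Proof. by rewrite count_eventP II0 card_eq0; split=> /eqP. Qed.

Lemma count_event1 A omega :
  count_event Phi A 1 omega <-> singleton (Phi omega `&` A).
Proof.
rewrite count_eventP; split; last by move=> [x ->]; exact: card_set1.
move=> /eq_cardSP[x Ax]; rewrite II0 card_eq0 => /eqP E; exists x.
by rewrite -(setD1K Ax) E setU0.
Qed.

Lemma count_event2 A omega : count_event Phi A 2 omega <->
  exists x y, x <> y /\ Phi omega `&` A = [set x; y].
Proof.
rewrite count_eventP; split.
  move=> /eq_cardSP[x Ax] /eq_cardSP[y Ay]; rewrite II0 card_eq0 => /eqP E.
  exists x, y; split; first by case: Ay => _ /nesym.
  by rewrite -(setD1K Ax) -(setD1K Ay) E setU0.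
move=> [x [y [xy ->]]]; apply/eq_cardSP; exists x; first by left.
apply/eq_cardSP; exists y; first by split; [right|exact: nesym].
rewrite II0 card_eq0; apply/eqP/seteqP; split=> // t [[[->|->] h] h'].
  exact: h.
exact: h'.
Qed.

Lemma measurable_count_event A k : measurable A -> measurable (count_event Phi
  A k).
Proof.
move=> mA; have [[_ /(_ A mA) mc] _ _] := PhiP.
rewrite -[X in measurable X]setTI.
exact: (mc measurableT [set k%:R%:E] (emeasurable_set1 _)).
Qed.

Local Notation m := (@real_area R).

Let m_ge0 A : 0 <= m A.
Proof. by rewrite /real_area fine_ge0// measure_ge0. Qed.

Lemma real_areaD A B : measurable A -> measurable B -> bounded_set B -> A `<=`
  B ->
  m (B `\` A) = m B - m A.
Proof.
move=> mA mB bB AB; rewrite /real_area /area measureD//.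
  rewrite setIidr// fineB//; first exact: area_fin.
  apply: area_fin => //; exact: sub_bounded_set AB bB.
by rewrite ltey_eq area_fin.
Qed.

Lemma prob_count0 A : measurable A -> bounded_set A ->
  P (count_event Phi A 0) = (expR (- lam * m A))%:E.
Proof.
move=> mA bA; have [_ -> // _] := PhiP; rewrite /poisson_prob -/(m A).
case: ifPn => [m0|].
  rewrite esum_set1 ?lee_fin ?poisson_pmf_ge0// /poisson_pmf m0.
  by rewrite expr0 fact0 invr1 !mul1r mulNr.
rewrite -leNgt pmulr_rle0// => m0.
have -> : m A = 0 by apply/le_anti; rewrite m0 m_ge0.
by rewrite mulr0 expR0 diracE mem_set.
Qed.

Lemma prob_count1 A : measurable A -> bounded_set A ->
  P (count_event Phi A 1) = (lam * m A * expR (- lam * m A))%:E.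
Proof.
move=> mA bA; have [_ -> // _] := PhiP; rewrite /poisson_prob -/(m A).
case: ifPn => [m0|].
  rewrite esum_set1 ?lee_fin ?poisson_pmf_ge0// /poisson_pmf m0.
  by rewrite expr1 (_ : 1`! = 1)%N// invr1 !mulr1 mulNr.
rewrite -leNgt pmulr_rle0// => m0.
have -> : m A = 0 by apply/le_anti; rewrite m0 m_ge0.
by rewrite mulr0 mul0r diracE memNset.
Qed.

Lemma prob_count_indep A B i j : measurable A -> measurable B ->
  bounded_set A -> bounded_set B -> A `&` B = set0 ->
  P (count_event Phi A i `&` count_event Phi B j) =
  (P (count_event Phi A i) * P (count_event Phi B j))%E.
Proof.
move=> mA mB bA bB AB; have [_ _ H] := PhiP.
have := H 2 (fun k => if k == ord0 then A else B)
  (fun k => if k == ord0 then i else j).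
rewrite big_ord_recl big_ord1 /= => <-; last 3 first.
- by move=> k; case: ifP.
- by move=> k; case: ifP.
- move=> k l _ _ [x]; case: (eqVneq k ord0) => [->|k0];
  case: (eqVneq l ord0) => [->//|l0] [].
  + by move=> Ax Bx; have : (A `&` B) x by []; rewrite AB.
  + by move=> Bx Ax; have : (A `&` B) x by []; rewrite AB.
  + by move=> _ _; apply: val_inj; case: k k0 => -[|[|]]//;
    case: l l0 => -[|[|]].
congr (P _); apply/seteqP; split => omega.
  by move=> [Ai Bj] k _ /=; case: ifP.
by move=> H'; split; [exact: (H' ord0)|exact: (H' (lift ord0 ord0))].
Qed.

(** The counts in [D] and in [B] minus [D] are independent, and the two exponents add up to that of
    [B]. *)
Lemma prob_one_in D B : measurable D -> measurable B -> bounded_set B ->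
  D `<=` B ->
  P (count_event Phi D 1 `&` count_event Phi (B `\` D) 0) =
  (lam * m D * expR (- lam * m B))%:E.
Proof.
move=> mD mB bB DB.
have bD : bounded_set D by exact: sub_bounded_set DB bB.
have bBD : bounded_set (B `\` D) by apply: sub_bounded_set bB => x [].
have mBD : measurable (B `\` D) by exact: measurableD.
rewrite prob_count_indep//; last by rewrite setDE setICA setICr setI0.
rewrite (prob_count1 mD bD) (prob_count0 mBD bBD) (real_areaD mD mB bB DB).
rewrite -EFinM; congr EFin.
move: (m D) (m B) => x y.
by rewrite -[LHS]mulrA -expRD; congr (_ * expR _); ring.
Qed.

(** By independence the probability is exp(-lam |C|) (1 - exp(-lam |A|)), and 1 - exp(-t) <= t. *)
Lemma prob_none_some C A : measurable C -> measurable A ->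
  bounded_set C -> bounded_set A -> C `&` A = set0 ->
  (P (count_event Phi C 0 `\` count_event Phi A 0) <=
   (lam * m A * expR (- lam * m C))%:E)%E.
Proof.
move=> mC mA bC bA CA.
have -> : P (count_event Phi C 0 `\` count_event Phi A 0) =
    (P (count_event Phi C 0) -
     P (count_event Phi C 0) * P (count_event Phi A 0))%E.
  rewrite -prob_count_indep//; apply: measureD.
  - exact: measurable_count_event.
  - exact: measurable_count_event.
  - by rewrite ltey_eq fin_num_measure//; exact: measurable_count_event.
rewrite (prob_count0 mC bC) (prob_count0 mA bA) -EFinM -EFinB lee_fin.
move: (m A) (m C) => x y.
have := expR_ge1Dx (- lam * x); have := expR_gt0 (- lam * y); nra.
Qed.

(** With x = lam |A|, exp(-x) >= 1 - x gives 1 - (1 + x) exp(-x) <= x^2. The quadratic order is what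
    lets a sum over many small annuli tend to 0. *)
Lemma prob_two_more A : measurable A -> bounded_set A ->
  (P (~` (count_event Phi A 0 `|` count_event Phi A 1)) <= ((lam * m A) ^+
    2)%:E)%E.
Proof.
move=> mA bA.
have m0 := measurable_count_event 0 mA; have m1 := measurable_count_event 1 mA.
rewrite probability_setC; last exact: measurableU.
have -> : P (count_event Phi A 0 `|` count_event Phi A 1) =
    (P (count_event Phi A 0) + P (count_event Phi A 1))%E.
  apply: measureU => //; apply/seteqP; split => // omega [].
  move=> /count_event0 E /count_event1[x]; rewrite E.
  by move=> /seteqP[_ /(_ x)]; exact.
rewrite (prob_count0 mA bA) (prob_count1 mA bA) -EFinD.
rewrite lee_fin.
have : 0 <= lam * m A by rewrite mulr_ge0// ltW.
rewrite mulNr; move: (lam * m A) => x x0.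
by have := expR_ge1Dx (- x); nra.
Qed.

End poisson.

(** * Almost sure genericity *)

Lemma negligible_inv_bound d (T : measurableType d) (R : realType)
    (P : probability T R) (Z : set T) (A : nat -> set T) (c : R) :
  (forall n, measurable (A n)) -> (forall n, Z `<=` A n) ->
  (forall n, (P (A n) <= (c / n.+1%:R)%:E)%E) -> P.-negligible Z.
Proof.
move=> mA ZA PA; have mI : measurable (\bigcap_n A n).
  exact: bigcap_measurable.
exists (\bigcap_n A n); split => //; last by move=> z Zz n _; exact: ZA.
have IA n : (P (\bigcap_n A n) <= (c / n.+1%:R)%:E)%E.
  apply: le_trans (PA n); apply: le_measure; rewrite ?inE//.
  exact: bigcap_inf.
apply/eqP; rewrite eq_le measure_ge0 andbT.
have Pfin : P (\bigcap_n A n) \is a fin_num by exact: fin_num_measure.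
rewrite -(fineK Pfin) lee_fin leNgt; apply/negP => x0.
(* For this index n, c / (n + 1) is smaller than the supposedly positive probability. *)
have := IA (Num.truncn (c / fine (P (\bigcap_n A n)))).
rewrite -(fineK Pfin) lee_fin ler_pdivlMr ?ltr0Sn// mulrC -ler_pdivlMr//.
by rewrite leNgt truncnS_gt.
Qed.

Lemma le_of_le_mul (R : realFieldType) (p i : R) :
  0 <= i -> (forall t, 1 < t -> p <= t * i) -> p <= i.
Proof.
move=> i0 H; apply/ler_addgt0Pr => e e0.
have i1 : 0 < i + 1 by rewrite ltr_wpDl.
(* For this factor [t], t i = i + e i / (i + 1) <= i + e; the denominator stays positive when
   [i = 0]. *)
have := H (1 + e / (i + 1)); rewrite ltrDl divr_gt0// => /(_ isT) /le_trans;
  apply.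
rewrite mulrDl mul1r lerD2l mulrAC ler_pdivrMr//.
by rewrite ler_pM2l// lerDl.
Qed.

Section null_events.
Context {d : measure_display} {T : measurableType d} {R : realType}.
Variables (P : probability T R) (lam : R) (Phi : T -> set (R * R)).
Hypothesis lam0 : 0 < lam.
Hypothesis PhiP : homogeneous_poisson P lam Phi.
Variable w : R * R.
Local Notation a := (lam * pi).

Let a0 : 0 < a.
Proof. by rewrite mulr_gt0// pi_gt0. Qed.

Let mN A k : measurable A -> measurable (count_event Phi A k).
Proof. exact: (measurable_count_event PhiP). Qed.

Lemma real_area_disc (s : R) : 0 <= s -> real_area (disc w s) = pi * s.
Proof. by move=> s0; rewrite /real_area area_disc. Qed.

Lemma real_area_ring (h : R) k : 0 < h ->
  real_area (level (sqdist w) h k) = pi * h.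
Proof.
move=> h0; have kh : k%:R * h <= k.+1%:R * h by rewrite ler_pM2r// ler_nat.
have -> : level (sqdist w) h k = disc w (k.+1%:R * h) `\` disc w (k%:R * h).
  apply/seteqP; split=> [x /andP[kx xk]|x [xk /negP]].
    by split=> //; apply/negP; rewrite -leNgt.
  by rewrite -leNgt /level /= => ->.
rewrite real_areaD; last 4 first.
- exact: measurable_disc.
- exact: measurable_disc.
- exact: bounded_disc.
- by move=> x /lt_le_trans; exact.
rewrite !real_area_disc ?mulr_ge0 ?ler0n ?(ltW h0)//.
rewrite -mulrBr -mulrBl.
by rewrite -natrB// subSnn mul1r.
Qed.

Lemma ring_bounded (h : R) k : bounded_set (level (sqdist w) h k).
Proof. by apply: sub_bounded_set (bounded_disc w _) => x;
  exact: level_disc. Qed.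

(** The bound [M] makes finitely many annuli of a given width sufficient; integer values of [M]
    exhaust the plane. *)
Definition ties (M : R) : set T :=
  [set omega | exists x y, [/\ Phi omega x, Phi omega y, x <> y,
     sqdist w x = sqdist w y & sqdist w x < M]].

(* The disc of squared radius [M] is cut into [n.+1] annuli of equal area; two
   equidistant points share an annulus, which happens with probability
   O(n.+1 * n.+1^-2). *)
Lemma negligible_ties (M : R) : 0 < M -> P.-negligible (ties M).
Proof.
move=> M0.
pose A n k := ~` (count_event Phi (level (sqdist w) (M / n.+1%:R) k) 0 `|`
  count_event Phi (level (sqdist w) (M / n.+1%:R) k) 1).
have mL n k : measurable (level (sqdist w) (M / n.+1%:R) k).
  by apply: measurable_level; exact: measurable_sqdist.
have mA n k : measurable (A n k).
  by apply: measurableC; apply: measurableU; exact: mN.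
apply: (@negligible_inv_bound _ _ _ _ _
  (fun n => \big[setU/set0]_(k < n.+1) A n k) ((a * M) ^+ 2)).
- by move=> n; apply: bigsetU_measurable => k _; exact: mA.
- move=> n omega [x [y [Sx Sy xy e xM]]]; rewrite -bigcup_mkord.
  have h0 : 0 < M / n.+1%:R by rewrite divr_gt0.
  have [k xk] := exists_level h0 (sqdist_ge0 w x).
  have yk : level (sqdist w) (M / n.+1%:R) k y by rewrite /level /= -e.
  exists k => /=.
    have /andP[+ _] := xk => /le_lt_trans /(_ xM).
    by rewrite mulrCA gtr_pMr// ltr_pdivrMr// mul1r ltr_nat.
  rewrite /A => -[/count_event0 /seteqP[/(_ x) h _]|/count_event1[z zE]].
    by apply: h.
  apply: xy; have : [set z] x by rewrite -zE.
  by move=> ->; have : [set z] y by rewrite -zE.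
move=> n; apply: (le_trans (Boole_inequality P _)) => [k _|]; first exact: mA.
have le2 (k : 'I_n.+1) : (P (A n k) <= ((a * (M / n.+1%:R)) ^+ 2)%:E)%E.
  apply: le_trans (prob_two_more lam0 PhiP (mL n k) (ring_bounded _ _)) _.
  by rewrite real_area_ring ?divr_gt0// mulrA.
apply: (le_trans (lee_sum _ (fun k _ => le2 k))).
rewrite sumEFin lee_fin sumr_const card_ord -[leLHS]mulr_natl.
have : n.+1%:R != 0 :> R by rewrite pnatr_eq0.
by move: (n.+1%:R : R) => N N0; rewrite le_eqVlt; apply/predU1P; left; field.
Qed.

Definition scarce : set T :=
  [set omega | ~ exists x y, [/\ Phi omega x, Phi omega y & x <> y]].

Lemma negligible_scarce : P.-negligible scarce.
Proof.
(* The squared radius is chosen so that the mean number of points in [B n] is [n.+1]. *)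
pose B n := disc w (n.+1%:R / a).
have mB n : measurable (B n) by exact: measurable_disc.
have bB n : bounded_set (B n) by exact: bounded_disc.
apply: (@negligible_inv_bound _ _ _ _ _
  (fun n => count_event Phi (B n) 0 `|` count_event Phi (B n) 1) 4).
- by move=> n; apply: measurableU; exact: mN.
- move=> n omega H; have [N0|N0] := pselect (count_event Phi (B n) 0 omega).
    by left.
  right; apply/count_event1; have /set0P[x Bx] : Phi omega `&` B n != set0.
    by apply/eqP => E; apply: N0; apply/count_event0.
  exists x; apply/seteqP; split=> [y [Sy _]|y -> //].
  by apply: contrapT => yx; apply: H; exists y, x; split => //; case: Bx.
move=> n.
have PU : (P (count_event Phi (B n) 0 `|` count_event Phi (B n) 1) <=
    P (count_event Phi (B n) 0) + P (count_event Phi (B n) 1))%E.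
  by apply: measureU2; exact: mN.
apply: (le_trans PU).
rewrite (prob_count0 lam0 PhiP (mB n) (bB n)) (prob_count1 lam0 PhiP (mB n) (bB
  n)).
rewrite -EFinD lee_fin real_area_disc ?divr_ge0 ?(ltW a0)//.
have x0 : 0 < n.+1%:R :> R by exact: ltr0Sn.
move: (n.+1%:R : R) x0 => x x0.
rewrite mulNr (_ : lam * (pi * (x / a)) = x); last first.
  move: pi (pi_gt0 R) => p p0.
  by field; rewrite !gt_eqF.
(* Squaring exp(x/2) >= 1 + x/2 gives x (1 + x) exp(-x) <= 4 x (1 + x) / (2 + x)^2 <= 4, the origin
   of the constant 4. *)
have := expR_ge1Dx (x / 2).
have -> : expR (- x) = (expR (x / 2) ^+ 2)^-1.
  by rewrite -expRM_natl expRN; congr (expR _)^-1; field.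
move=> e1; rewrite ler_pdivlMr//.
have e0 : 0 < expR (x / 2) by exact: expR_gt0.
rewrite (_ : _ * x = (1 + x) * x / expR (x / 2) ^+ 2); last by ring.
rewrite ler_pdivrMr ?exprn_gt0//; nra.
Qed.

Definition generic : set T :=
  [set omega | (exists x y, [/\ Phi omega x, Phi omega y & x <> y]) /\
     forall x y, Phi omega x -> Phi omega y -> sqdist w x = sqdist w y -> x =
       y].

Lemma negligible_nongeneric : P.-negligible (~` generic).
Proof.
apply: (@negligibleS _ _ _ _ (scarce `|` \bigcup_n ties n.+1%:R)).
  move=> omega /not_andP[|H]; [by left|right].
  apply: contrapT => NT; apply: H => x y Sx Sy e.
  apply: contrapT => xy; apply: NT; exists (Num.truncn (sqdist w x)) => //.
  by exists x, y; split=> //; exact: truncnS_gt.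
apply: negligibleU; first exact: negligible_scarce.
by apply: negligible_bigcup => n; exact: negligible_ties.
Qed.

End null_events.

(** * Probability of an isolated point *)

Section isolated.
Context {d : measure_display} {T : measurableType d} {R : realType}.
Variables (P : probability T R) (lam : R) (Phi : T -> set (R * R)).
Hypothesis lam0 : 0 < lam.
Hypothesis PhiP : homogeneous_poisson P lam Phi.
Variables (w : R * R) (g : R * R -> R).
Hypothesis mg : measurable_fun [set: R * R] g.
Hypothesis sqdist_g : forall x, sqdist w x <= g x.
Local Notation a := (lam * pi).
Local Notation mu2 := (@lebesgue_measure R \x @lebesgue_measure R)%E.

(** The intensity times the probability that the disc of squared radius [g z] is empty:
    heuristically, the density of witnesses of [isolated]. *)
Let f (z : R * R) : \bar R := (lam * expR (- a * g z))%:E.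

Let a0 : 0 < a.
Proof. by rewrite mulr_gt0// pi_gt0. Qed.

Let f0 z : (0 <= f z)%E.
Proof. by rewrite lee_fin mulr_ge0 ?expR_ge0// ltW. Qed.

Let mf : measurable_fun [set: R * R] f.
Proof.
apply/measurable_EFinP; apply: measurable_funM => //.
apply: (measurableT_comp (f := @expR R)).
  by apply: continuous_measurable_fun; exact: continuous_expR.
exact: measurable_funM.
Qed.

Let mN A k : measurable A -> measurable (count_event Phi A k).
Proof. exact: (measurable_count_event PhiP). Qed.

Let g0 x : 0 <= g x.
Proof. exact: le_trans (sqdist_ge0 w x) (sqdist_g x). Qed.

Let areaE (A : set (R * R)) : measurable A -> bounded_set A -> mu2 A =
  (real_area A)%:E.
Proof. by move=> mA bA; rewrite /real_area fineK// area_fin. Qed.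

Definition isolated : set T :=
  [set omega | exists2 x, Phi omega x &
     forall t, Phi omega t -> t <> x -> g x <= sqdist w t].

Section fixed_mesh.
Variable h : R.
Hypothesis h0 : 0 < h.
Local Notation L := (level g h).
Local Notation B k := (disc w (k%:R * h)).

Let mL k : measurable (L k).
Proof. exact: measurable_level. Qed.

Let LB k : L k `<=` B k.+1.
Proof. exact: level_disc. Qed.

Let bL k : bounded_set (L k).
Proof. exact: sub_bounded_set (@LB k) (bounded_disc _ _). Qed.

Let kh0 k : 0 <= k%:R * h.
Proof. by rewrite mulr_ge0// ltW. Qed.

Let integral_levels : (\int[mu2]_z f z = \sum_(0 <= k <oo) \int[mu2]_(z in L k)
  f z)%E.
Proof.
rewrite -(bigcup_level h0 g0) ge0_integral_bigcup//.
  by rewrite bigcup_level.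
exact: trivIset_level.
Qed.

Let le_integral_level k :
  ((lam * real_area (L k) * expR (- a * (k.+1%:R * h)))%:E <=
   \int[mu2]_(z in L k) f z)%E.
Proof.
rewrite mulrAC EFinM -areaE// -integral_cst; last exact: mL.
apply: ge0_le_integral => //.
- exact: mL.
- by move=> z _; rewrite /= lee_fin mulr_ge0 ?expR_ge0// ltW.
- exact: measurable_funTS.
move=> z /andP[_ zk]; rewrite lee_fin ler_pM2l// ler_expR !mulNr lerN2.
by rewrite ler_pM2l// ltW.
Qed.

Let ge_integral_level k :
  (\int[mu2]_(z in L k) f z <=
   (lam * real_area (L k) * expR (- a * (k%:R * h)))%:E)%E.
Proof.
rewrite mulrAC EFinM -areaE// -integral_cst; last exact: mL.
apply: ge0_le_integral => //.
- exact: mL.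
- exact: measurable_funTS.
move=> z /andP[zk _]; rewrite lee_fin ler_pM2l// ler_expR !mulNr lerN2.
by rewrite ler_pM2l.
Qed.

(* [B k.+1] contains [L k] and all discs [sqdist w t < g x] with [x] in [L k]:
   a unique point in [B k.+1] lying in [L k] forces [isolated]. *)
Let inner k : set T :=
  count_event Phi (L k) 1 `&` count_event Phi (B k.+1 `\` L k) 0.

Let m_inner k : measurable (inner k).
Proof.
apply: measurableI; apply: mN => //; apply: measurableD => //.
exact: measurable_disc.
Qed.

Let inner_single k omega : inner k omega ->
  exists2 x, L k x & Phi omega `&` B k.+1 = [set x].
Proof.
move=> [/count_event1[x xE] /count_event0 E]; exists x.
  by have : [set x] x by []; rewrite -xE => -[].
rewrite -xE -[B k.+1](setDUK (@LB k)) setIUr E setU0.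
by [].
Qed.

(** The discs are nested, so the only point in the smaller one is also the only point in the larger
    one and would lie in both levels. Disjointness turns the lower bound into a sum; the upper bound
    uses only subadditivity. *)
Let trivIset_inner : trivIset setT inner.
Proof.
move=> k j _ _ [omega [/inner_single[x xk xE] /inner_single[y yj yE]]].
wlog kj : k j x y xk xE yj yE / (k <= j)%N.
  move=> H; case/orP: (leq_total k j) => [|jk];
    first exact: (H _ _ _ _ xk xE yj yE).
  exact/esym/(H _ _ _ _ yj yE xk xE).
suff xy : x = y by apply: (level_inj h0 xk); rewrite xy.
have : (Phi omega `&` B j.+1) x.
  have [Sx xB] : (Phi omega `&` B k.+1) x by rewrite xE.
  by split=> //; apply: (lt_le_trans xB); rewrite ler_pM2r// ler_nat.
by rewrite yE.
Qed.

Let integral_le_inner : ((expR (- (a * h)))%:E * \int[mu2]_z f z <=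
  P (\bigcup_k inner k))%E.
Proof.
rewrite measure_bigcup//.
rewrite integral_levels -nneseriesZl; last first.
  by move=> k _; exact: integral_ge0.
rewrite [leRHS](eq_eseriesl (Q := xpredT)); last by move=> k; rewrite in_setT.
apply: lee_nneseries => [k _ _|k _].
  by apply: mule_ge0; [rewrite lee_fin expR_ge0|exact: integral_ge0].
have := prob_one_in lam0 PhiP (mL k) (measurable_disc _ _) (bounded_disc _ _)
  (@LB k).
rewrite real_area_disc// => PE; rewrite [leRHS]PE.
apply: (le_trans (lee_wpmul2l _ (ge_integral_level k))).
  by rewrite lee_fin expR_ge0.
(* The factor exp(-a h) is exactly what separates exp(-a k h), the bound of the exponential on the
   level, from exp(-a (k + 1) h). *)
rewrite -EFinM lee_fin mulrCA -expRD le_eqVlt; apply/predU1P; left.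
by congr (_ * expR _); rewrite -natr1; ring.
Qed.

(* Conversely, a point [x] of [L k] witnessing [isolated] is alone in [B k] if it
   lies there, and otherwise [B k] is empty. *)
Let outer k : set T :=
  (count_event Phi (L k `&` B k) 1 `&`
   count_event Phi (B k `\` (L k `&` B k)) 0) `|`
  (count_event Phi (B k) 0 `\` count_event Phi (L k `\` (L k `&` B k)) 0).

Let m_outer k : measurable (outer k).
Proof.
have mB : measurable (B k) by exact: measurable_disc.
have mLB : measurable (L k `&` B k) by exact: measurableI.
apply: measurableU; first by apply: measurableI; apply: mN => //;
  exact: measurableD.
by apply: measurableD; apply: mN => //; exact: measurableD.
Qed.

(** The two parts contribute lam |L k inside B k| and lam |L k outside B k|, both times exp(-lam |B
    k|), so their sum involves the whole area of [L k]. *)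
Let prob_outer k :
  (P (outer k) <= (lam * real_area (L k) * expR (- a * (k%:R * h)))%:E)%E.
Proof.
have mB : measurable (B k) by exact: measurable_disc.
have bB : bounded_set (B k) by exact: bounded_disc.
have mLB : measurable (L k `&` B k) by exact: measurableI.
have mD : measurable (L k `\` (L k `&` B k)) by exact: measurableD.
have bD : bounded_set (L k `\` (L k `&` B k)).
  by apply: sub_bounded_set (@bL k) => x [].
have mE1 : measurable (count_event Phi (L k `&` B k) 1 `&`
   count_event Phi (B k `\` (L k `&` B k)) 0).
  by apply: measurableI; apply: mN => //; exact: measurableD.
have mE2 : measurable (count_event Phi (B k) 0 `\`
    count_event Phi (L k `\` (L k `&` B k)) 0).
  by apply: measurableD; exact: mN.
have p1 := prob_one_in lam0 PhiP mLB mB bB (@subIsetr _ _ _).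
have p2 := prob_none_some lam0 PhiP mB mD bB bD.
apply: (@le_trans _ _ (P (count_event Phi (L k `&` B k) 1 `&`
   count_event Phi (B k `\` (L k `&` B k)) 0) + P (count_event Phi (B k) 0 `\`
    count_event Phi (L k `\` (L k `&` B k)) 0))%E).
  exact: measureU2.
have BL0 : B k `&` (L k `\` (L k `&` B k)) = set0.
  by apply/seteqP; split=> // x [xB [xL]]; apply.
rewrite [X in (X + _)%E]p1; apply: (le_trans (leeD2l _ (p2 BL0))).
rewrite -EFinD lee_fin (real_areaD mLB (mL k) (@bL k) (@subIsetl _ _ _))
  real_area_disc//.
rewrite (mulrA (- lam)) mulNr;
  move: (real_area _) (real_area _) (expR _) => p q e.
by rewrite le_eqVlt; apply/predU1P; left; ring.
Qed.

(** [isolated] is compared with the measurable [E] only off [Z]. Adjoining a measurable null set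
    that covers [Z] to the larger side makes each inclusion hold everywhere. *)
Lemma prob_isolated_mesh (E Z : set T) : measurable E -> P.-negligible Z ->
  (forall omega, ~ Z omega -> (E omega <-> isolated omega)) ->
  ((expR (- (a * h)))%:E * \int[mu2]_z f z <= P E)%E /\
  (P E <= (expR (a * h))%:E * \int[mu2]_z f z)%E.
Proof.
move=> mE [N [mNull PN ZN]] EZ.
have EN : P (E `|` N) = P E by exact: measureU0.
split.
  apply: (le_trans integral_le_inner); rewrite -EN.
  apply: le_measure; rewrite ?inE;
    [exact: bigcup_measurable|exact: measurableU|].
  move=> omega [k _ /inner_single[x /andP[_ xk] xE]].
  have [Zo|/EZ Eo] := pselect (Z omega); first by right; exact: ZN.
  left; apply/Eo; exists x.
    by have [] : (Phi omega `&` B k.+1) x by rewrite xE.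
  move=> t St tx; apply: (le_trans (ltW xk)); rewrite leNgt; apply/negP => tB.
  by apply: tx; have : (Phi omega `&` B k.+1) t by []; rewrite xE.
have mU : measurable (\bigcup_k outer k) by exact: bigcup_measurable.
apply: (@le_trans _ _ (P (\bigcup_k outer k))).
  have <- : P (\bigcup_k outer k `|` N) = P (\bigcup_k outer k) by exact:
    measureU0.
  apply: le_measure; rewrite ?inE//; first exact: measurableU.
  move=> omega Eo; have [Zo|/EZ iso] := pselect (Z omega).
    by right; exact: ZN.
  left; have [x Sx xP] := iso.1 Eo.
  have [k xk] := exists_level h0 (g0 x); exists k => //.
  have /andP[kx _] := xk.
  have notB t : Phi omega t -> B k t -> t = x.
    move=> St tB; apply: contrapT => /(xP _ St) /(le_trans kx).
    by rewrite leNgt tB.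
  have [xB|xB] := pselect (B k x).
    left; split.
      apply/count_event1; exists x; apply/seteqP;
        split=> [t [St [_ tB]]|t -> //].
      exact: notB.
    apply/count_event0/seteqP; split=> // t [St [tB]]; rewrite (notB _ St tB).
    by apply.
  right; split.
    by apply/count_event0/seteqP; split=> // t [St tB]; apply: xB;
      rewrite -(notB _ St tB).
  move=> /count_event0 /seteqP[/(_ x) + _]; apply; split=> //; split=> // -[_].
  exact: xB.
apply: (le_trans (generalized_Boole_inequality P m_outer mU)).
rewrite integral_levels -nneseriesZl; last by move=> k _; exact: integral_ge0.
apply: lee_nneseries => [k _ _|k _]; first exact: measure_ge0.
apply: (le_trans (prob_outer k)).
apply: (@le_trans _ _ ((expR (a * h))%:E *
  (lam * real_area (L k) * expR (- a * (k.+1%:R * h)))%:E)%E).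
  rewrite -EFinM lee_fin [leRHS]mulrCA -expRD le_eqVlt; apply/predU1P; left.
  by congr (_ * expR _); rewrite -natr1; ring.
by apply: lee_wpmul2l; [rewrite lee_fin expR_ge0|exact: le_integral_level].
Qed.
End fixed_mesh.

Lemma prob_isolated (E Z : set T) : measurable E -> P.-negligible Z ->
  (forall omega, ~ Z omega -> (E omega <-> isolated omega)) ->
  P E = (\int[mu2]_z f z)%E.
Proof.
move=> mE NZ EZ.
have H h (h0 : 0 < h) := prob_isolated_mesh h0 mE NZ EZ.
have I0 : (0 <= \int[mu2]_z f z)%E by apply: integral_ge0 => z _; exact: f0.
have PE : P E \is a fin_num by exact: fin_num_measure.
have IE : (\int[mu2]_z f z)%E \is a fin_num.
  (* The lower bound for mesh 1 already forces the integral to be finite, as a probability cannot be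
     infinite. *)
  rewrite ge0_fin_numE//; have := (H _ ltr01).1.
  case: (\int[mu2]_z f z)%E I0 => [r _ _|_|//]; first by rewrite ltry.
  by rewrite gt0_muley ?lte_fin ?expR_gt0// leye_eq => /eqP PEy;
    rewrite PEy in PE.
move: H I0; rewrite -(fineK PE) -(fineK IE).
move: (fine (P E)) (fine (\int[mu2]_z f z)%E) (fine_ge0 (measure_ge0 P E)) =>
  p i p0 H i0.
rewrite lee_fin in i0.
(* Every factor [t] above 1 is exp(a h) for the mesh h = ln t / a, so letting h tend to 0 becomes
   letting [t] tend to 1. *)
have ht t : 1 < t -> expR (a * (ln t / a)) = t.
  move=> t1; rewrite mulrC divfK ?gt_eqF// lnK// posrE.
  exact: lt_trans t1.
have {}H t : 1 < t -> i <= t * p /\ p <= t * i.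
  move=> t1; have h0 : 0 < ln t / a by rewrite divr_gt0// ln_gt0.
  have [] := H _ h0; rewrite -!EFinM !lee_fin expRN ht// => ip pi'; split => //.
  by rewrite mulrC -ler_pdivrMr ?(lt_trans _ t1)// mulrC.
congr EFin; apply/le_anti/andP; split; apply: le_of_le_mul => // t /H[] //.
Qed.
End isolated.

(** * The event of the theorem *)

Lemma shat_le (R : realType) (xs xd x y : R * R) :
  let w := midpoint xs xd in
  (shat xs xd x <= Num.sqrt (enorm (xs - w) ^+ 2 + enorm (y - w) ^+ 2)) =
  (cusp w (xs - w) x <= sqdist w y).
Proof.
move=> w; rewrite /shat ge_max /cusp.
have sq (z : R * R) : enorm z ^+ 2 = z.1 ^+ 2 + z.2 ^+ 2.
  by rewrite sqr_sqrtr// addr_ge0// sqr_ge0.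
rewrite !ler_sqrt ?addr_ge0 ?sqr_ge0// !sq /sqdist /=.
(* After squaring, the two bounds in the maximum say that -2 c and 2 c are at most
   [sqdist w y - sqdist w x], that is, |2 c| is. *)
set c := (_ * _ + _ * _); rewrite -[2 * `|c|]ger0_norm ?mulr_ge0//.
rewrite normrM normr_id -normrM -[RHS]lerBrDl ler_norml.
by apply/andP/andP => -[]; rewrite /c /= /GRing.scale /= => h1 h2; split; lra.
Qed.

Section E_suff.
Context {d : measure_display} {T : measurableType d} {R : realType}.
Variables (P : probability T R) (lam : R) (Phi : T -> set (R * R)).
Variables xs xd : R * R.
Hypothesis lam0 : 0 < lam.
Hypothesis PhiP : homogeneous_poisson P lam Phi.
Local Notation w := (midpoint xs xd).
Local Notation g := (cusp w (xs - w)).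

Let Phi_lf omega : locally_finite (Phi omega).
Proof. by case: PhiP => -[Plf _] _ _ B; exact: Plf. Qed.

Let sqdist_g x : sqdist w x <= g x.
Proof. by rewrite lerDl mulr_ge0. Qed.

Let gw : g w = 0.
Proof. by rewrite /cusp /sqdist !subrr !mulr0 expr0n /= !addr0 normr0 mulr0
  addr0. Qed.

Lemma measurable_E_suff : measurable (E_suff Phi xs xd).
Proof.
pose N A k := count_event Phi A k.
have mN A k : measurable A -> measurable (N A k).
  exact: (measurable_count_event PhiP).
have mB q : measurable (disc w q) by exact: measurable_disc.
have mC q s : measurable (disc w q `&` [set x | s < g x]).
  apply: measurableI => //.
  rewrite (_ : [set x | s < g x] = [set x | - g x < - s]).
    apply: measurable_sublevel; apply: measurableT_comp => //.
    exact: measurable_cusp.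
  by apply/seteqP; split=> x /=; rewrite ltrN2.
(* The configurations excluded in the last case of [suff_countable]: the nearest point [x] has
   [s < g x], yet at least two points have squared distance below [s]. *)
pose V q s := N (disc w q) 1 `&` N (disc w q `&` [set x | s < g x]) 1
  `\` (N (disc w s) 0 `|` N (disc w s) 1).
have -> : E_suff Phi xs xd =
    ~` (\bigcup_(q : rat) N (disc w (ratr q)) 1) `|` ~` N [set w] 0 `|`
    ((\bigcup_(q : rat) N (disc w (ratr q)) 2) `\`
     (\bigcup_(q : rat) \bigcup_(s : rat) V (ratr q) (ratr s))).
  apply/seteqP; split => omega.
    rewrite /E_suff /= shat_le.
    move=> /(suff_countable sqdist_g gw (@Phi_lf omega))[H|Sw|[[q qE] H]].
    - by left; left=> -[q _ /count_event1]; exact: H.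
    - by left; right=> /count_event0 /seteqP[/(_ w) + _]; apply.
    - right; split; first by exists q => //; exact/count_event2.
      move=> [q' _ [s _ [[/count_event1 h1 /count_event1 h2] /not_orP[h3 h4]]]].
      apply: (H q' s); split=> // [h|h]; first by apply: h3; exact/count_event0.
      by apply: h4; exact/count_event1.
  move=> H; rewrite /E_suff /= shat_le.
  apply/(suff_countable sqdist_g gw (@Phi_lf omega)).
  case: H => [[H|H]|[[q _ /count_event2 qE] H]].
  - by apply: Or31 => q h; apply: H; exists q => //; exact/count_event1.
  - apply: Or32; apply: contrapT => Sw; apply: H; apply/count_event0.
    by apply/seteqP; split=> // x [Sx xw]; apply: Sw; rewrite -xw.
  - apply: Or33; split; first by exists q.
    move=> q' s [h1 h2 h3 h4]; apply: H; exists q' => //; exists s => //.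
    split; first by split; exact/count_event1.
    by move=> [/count_event0|/count_event1].
have m1 (v : R * R) : measurable [set v].
  case: v => p q; rewrite (_ : [set (p, q)] = [set p] `*` [set q]).
    exact: measurableX.
  by apply/seteqP; split=> [x ->//|[? ?] [/= -> ->]].
have mV q s : measurable (V q s).
  apply: measurableD; first by apply: measurableI; exact: mN.
  by apply: measurableU; exact: mN.
apply: measurableU; first apply: measurableU.
- by apply: measurableC; apply: bigcupT_measurable_rat => q; exact: mN.
- by apply: measurableC; exact: mN.
apply: measurableD; first by apply: bigcupT_measurable_rat => q; exact: mN.
by do 2 (apply: bigcupT_measurable_rat => ?); exact: mV.
Qed.

Lemma E_suff_isolated omega : generic Phi w omega ->
  E_suff Phi xs xd omega <-> isolated Phi w g omega.
Proof.
move=> [[x [y [Sx Sy xy]]] Sinj]; rewrite /E_suff /= shat_le.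
exact: (generic_nearest sqdist_g (@Phi_lf omega) Sx Sy xy Sinj).
Qed.

Lemma prob_E_suff : P (E_suff Phi xs xd) =
  (expR (lam * pi * enorm (xs - w) ^+ 2) *
   erfc (Num.sqrt (lam * pi) * enorm (xs - w)))%:E.
Proof.
have a0 : 0 < lam * pi by rewrite mulr_gt0// pi_gt0.
rewrite (prob_isolated lam0 PhiP (measurable_cusp _ _) sqdist_g
  measurable_E_suff (negligible_nongeneric lam0 PhiP w)); last first.
  by move=> omega /contrapT; exact: E_suff_isolated.
under eq_integral do rewrite EFinM.
rewrite ge0_integralZl//; last 2 first.
- apply/measurable_EFinP; apply: (measurableT_comp (f := @expR R)).
    by apply: continuous_measurable_fun; exact: continuous_expR.
  by apply: measurable_funM => //; exact: measurable_cusp.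
- by rewrite lee_fin ltW.
rewrite integral_cusp// -EFinM; congr EFin; rewrite [LHS]mulrA.
rewrite (_ : lam * (pi / (lam * pi)) = 1) ?mul1r//.
by rewrite mulrA divff// gt_eqF.
Qed.

End E_suff.

Theorem theorem2 (R : realType) (d : measure_display) (T : measurableType d)
    (P : probability T R) (lam : R) (Phi : T -> set (R * R))
    (xs xd : R * R) :
  0 < lam ->
  homogeneous_poisson P lam Phi ->
  let dist := enorm (xs - midpoint xs xd) in
  measurable (E_suff Phi xs xd) /\
  P (E_suff Phi xs xd) =
    (expR (lam * pi * dist ^+ 2) * erfc (Num.sqrt (lam * pi) * dist))%:E.
Proof.
move=> lam0 PhiP dist; split; first exact: measurable_E_suff PhiP.
exact: prob_E_suff.
Qed.
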